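(* Let $n\in\mathbb{N}$, let $\alpha_0,\dots,\alpha_n\in[0,\infty)$ with $\alpha_0<\dots<\alpha_n$, and let $0<a<b$. Set $\mathcal{F}=\{x^{\alpha_i}\}_{i=0}^n$ and let $L:\operatorname{lin}\mathcal{F}\to\mathbb{R}$ be a linear functional. Then the following are equivalent: (i) $L$ is a truncated $[a,b]$-moment functional. (ii) $L(p)\ge 0$ holds for all polynomials $p$ of the following forms and all points with $a<x_1<\dots<x_m<b$: if $n=2m$, both $$p(x)=\det\begin{pmatrix} x^{\alpha_0}&x^{\alpha_1}&x^{\alpha_2}&\dots&x^{\alpha_{2m-1}}&x^{\alpha_{2m}}\\ x&(x_1&x_1)&\dots&(x_m&x_m)\end{pmatrix}$$ and $$p(x)=-\det\begin{pmatrix} x^{\alpha_0}&x^{\alpha_1}&x^{\alpha_2}&x^{\alpha_3}&\dots&x^{\alpha_{2m-2}}&x^{\alpha_{2m-1}}&x^{\alpha_{2m}}\\ x&a&(x_1&x_1)&\dots&(x_{m-1}&x_{m-1})&b\end{pmatrix};$$ if $n=2m+1$, both $$p(x)=-\det\begin{pmatrix} x^{\alpha_0}&x^{\alpha_1}&x^{\alpha_2}&x^{\alpha_3}&\dots&x^{\alpha_{2m}}&x^{\alpha_{2m+1}}\\ x&a&(x_1&x_1)&\dots&(x_m&x_m)\end{pmatrix}$$ and $$p(x)=\det\begin{pmatrix} x^{\alpha_0}&x^{\alpha_1}&x^{\alpha_2}&\dots&x^{\alpha_{2m-1}}&x^{\alpha_{2m}}&x^{\alpha_{2m+1}}\\ 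x&(x_1&x_1)&\dots&(x_m&x_m)&b\end{pmatrix}.$$
   Context: $\operatorname{lin}\mathcal{F}$ is the real vector space of finite linear combinations of the functions in $\mathcal{F}$. $L$ is a truncated $[a,b]$-moment functional if there is a (positive) measure $\mu$ on $[a,b]$ with $L(f)=\int_a^b f\,d\mu$ for all $f\in\operatorname{lin}\mathcal{F}$. Matrix notation: for functions $g_0,\dots,g_n$ and points $z_0,\dots,z_n$, $\begin{pmatrix} g_0&\dots&g_n\\ z_0&\dots&z_n\end{pmatrix}$ denotes the $(n+1)\times(n+1)$ matrix whose row belonging to the point $z_k$ is $(g_0(z_k),\dots,g_n(z_k))$. A bracketed pair $(z\ \ z)$ in the bottom line stands for two consecutive rows: $(g_0(z),\dots,g_n(z))$ followed by the row of derivatives $(g_0'(z),\dots,g_n'(z))$. In the top line $x^{\alpha_i}$ denotes the function $t\mapsto t^{\alpha_i}$; the bottom-line entry $x$ is the variable of $p$. *)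

(* Defs.v *)
From HB Require Import structures.
From mathcomp Require Import all_boot all_order all_algebra.
From mathcomp Require Import all_classical all_reals all_analysis.
Import Order.TTheory GRing.Theory Num.Theory.
Import numFieldNormedType.Exports.

Set Implicit Arguments.
Unset Strict Implicit.
Unset Printing Implicit Defensive.

Local Open Scope classical_set_scope.
Local Open Scope ring_scope.

Section LinearSpan.
Context {R : realType} {n : nat} (F : 'I_n -> R -> R).

Definition in_lin : {pred R -> R} :=
  fun f => `[< exists c : 'I_n -> R, f = \sum_i c i *: F i >].

Lemma in_lin_submod_closed : submod_closed in_lin.
Proof.
split=> [|k f g].
  by apply/asboolP; exists (fun=> 0); rewrite big1// => i _; rewrite scale0r.
move=> /asboolP[c ->] /asboolP[d ->]; apply/asboolP.
exists (fun i => k * c i + d i); rewrite scaler_sumr -big_split/=.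
by apply: eq_bigr => i _; rewrite scalerA scalerDl.
Qed.

HB.instance Definition _ :=
  GRing.isSubmodClosed.Build R (R -> R) in_lin in_lin_submod_closed.

Record lin := Lin { lin_fun :> R -> R ; lin_funP : lin_fun \in in_lin }.

HB.instance Definition _ := [isSub for lin_fun].
HB.instance Definition _ := [Choice of lin by <:].
HB.instance Definition _ := [SubChoice_isSubLmodule of lin by <:].

End LinearSpan.

(* A measure on [a, b] is given as a Borel measure on R of which only the
   restriction to [a, b] is used. *)
Definition truncated_moment_functional {R : realType} {n : nat}
    {F : 'I_n -> R -> R} (a b : R) (L : {scalar lin F}) : Prop :=
  exists mu : {measure set (measurableTypeR R) -> \bar R},
    forall f : lin F,
      mu.-integrable `[a, b] (EFin \o f) /\
      ((L f)%:E = \int[mu]_(x in `[a, b]) (f x)%:E)%E.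

Definition powers {R : realType} {n : nat} (alpha : 'I_n -> R)
  : 'I_n -> R -> R := fun i t => t `^ alpha i.

(* The bottom line of the matrix notation is a sequence with one entry per row:
   (z, false) is the row of values at z, (z, true) the row of derivatives. *)
Definition single {R : realType} (z : R) : seq (R * bool) := [:: (z, false)].

Definition doubles {R : realType} (zs : seq R) : seq (R * bool) :=
  flatten [seq [:: (z, false); (z, true)] | z <- zs].

(* Meant for sequences s of size n; the default of nth is then irrelevant. *)
Definition node_mx {R : realType} {n : nat} (g : 'I_n -> R -> R)
    (s : seq (R * bool)) : 'M[R]_n :=
  \matrix_(k < n, i < n)
    let z := nth (0, false) s k in
    if z.2 then derive1 (g i) z.1 else g i z.1.

(* Main.v *)
Require Import Defs.
From HB Require Import structures.
From mathcomp Require Import all_boot all_order all_algebra.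
From mathcomp Require Import all_classical all_reals all_analysis.
From mathcomp Require Import measurable_realfun.
From mathcomp Require Import zify lra ring.
Import Order.TTheory GRing.Theory Num.Theory.
Import numFieldNormedType.Exports.
Local Open Scope classical_set_scope.
Local Open Scope ring_scope.

Set Implicit Arguments.
Unset Strict Implicit.
Unset Printing Implicit Defensive.

(** Real powers with increasing exponents form an extended Chebyshev system on
    the positive half-line: a nonzero combination of n + 1 of them has at most n
    zeros, double zeros counted twice ([gpoly_zeros]), and the determinants of
    the matrix notation are positive for increasing nodes ([ndet_gt0]).  So the
    polynomials of the theorem are nonnegative on [a, b], with zeros exactly at
    their nodes ([special_eq0], [special_gt0]).  A moment functional is
    nonnegative on them, which is one implication.

    For the converse, fix n + 1 points of (a, b) and let total p be the sum of
    the values of p there.  On the compact set of all p that are nonnegative on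
    [a, b] and have total p = 1, the functional L attains its minimum lam at
    some p ([minimizer]).  The functional M = L - lam total is nonnegative on
    all nonnegative elements and vanishes at p.  If q is positive at the zeros
    of p in [a, b], then p + eps q is nonnegative for small eps > 0, and so
    M q >= 0 ([touch_gt0]).  It follows that M q depends only on the values of q
    at the zeros of p, and monotonically; since interpolation at these few
    points is possible, M is a combination of evaluations at the zeros of p with
    nonnegative weights ([touch_repr]).

    What remains is lam >= 0.  The zeros of p in (a, b) are at least double, so
    the number of zeros, interior ones counted twice, is at most n ([zero_index]), and one
    of the given polynomials d can be chosen to vanish at all of them.  Then
    M d = 0, that is, L d = lam total d, where L d >= 0 by hypothesis and
    total d > 0.  When n is odd and p vanishes at both endpoints, d is a limit of
    the given polynomials, with a node that tends to b ([special_limit]).  Thus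
    L = lam total + M is integration against finitely many point masses
    ([atomic_moment]). *)

(** * Interpolation nodes and generalized polynomials *)

(** A list of nodes consists of pairs (point, whether it is a double node);
    its rows are the corresponding part of the bottom line of the matrix
    notation. *)
Definition rows {R : realType} (ns : seq (R * bool)) : seq (R * bool) :=
  flatten [seq if z.2 then [:: (z.1, false); (z.1, true)] else [:: (z.1, false)]
          | z <- ns].

(** The linear condition that a row imposes on a function. *)
Definition node_val {R : realType} (g : R -> R) (u : R * bool) : R :=
  if u.2 then derive1 g u.1 else g u.1.

(** The exponents are arbitrary reals, since dividing by a power and
    differentiating must stay within the class. *)
Definition gpoly {R : realType} {n : nat} (al c : 'I_n -> R) (x : R) : R :=
  \sum_i c i * x `^ al i.

Section ZeroCount.
Context {R : realType}.
Implicit Types (g : R -> R) (ns : seq (R * bool)) (zs : seq R).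

Lemma rows_cons z d ns :
  rows ((z, d) :: ns) = (z, false) :: nseq d (z, true) ++ rows ns.
Proof. by rewrite /rows/=; case: d. Qed.

Lemma rows_cat ns1 ns2 : rows (ns1 ++ ns2) = rows ns1 ++ rows ns2.
Proof. by rewrite /rows map_cat flatten_cat. Qed.

Lemma rows_single zs : rows [seq (z, false) | z <- zs] = [seq (z, false) | z <- zs].
Proof. by elim: zs => //= z zs ih; rewrite /rows /= -[in RHS]ih. Qed.

Lemma rows_double zs : rows [seq (z, true) | z <- zs] = doubles zs.
Proof. by rewrite /rows -map_comp. Qed.

Lemma size_doubles zs : size (doubles zs) = (size zs).*2.
Proof. by rewrite /doubles; elim: zs => //= z zs ->. Qed.

Lemma rows_fst ns u : u \in rows ns -> u.1 \in [seq v.1 | v <- ns].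
Proof.
elim: ns => // [[z d] ns ih]; rewrite rows_cons !inE mem_cat => /or3P[/eqP->|uz|/ih->].
- by rewrite eqxx.
- by move: uz; rewrite mem_nseq => /andP[_ /eqP->]; rewrite eqxx.
- by rewrite orbT.
Qed.

Lemma mem_rows ns z : z \in [seq v.1 | v <- ns] -> (z, false) \in rows ns.
Proof.
elim: ns => // [[y d] ns ih]; rewrite rows_cons !inE mem_cat => /predU1P[->|/ih->].
  by rewrite eqxx.
by rewrite !orbT.
Qed.

Lemma rows_gt0 ns u : path <%R 0 [seq v.1 | v <- ns] -> u \in rows ns -> 0 < u.1.
Proof. by rewrite lt_path_sortedE => /andP[/allP P _] /rows_fst/P. Qed.

(** Rolle's theorem yields a zero of the derivative in each gap between
    consecutive nodes, and each double node contributes itself. *)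
Lemma rolle_rows_from g (z : R) ns :
  (forall x, 0 < x -> derivable g x 1) -> 0 < z ->
  path <%R z [seq u.1 | u <- ns] -> g z = 0 ->
  {in rows ns, forall u, node_val g u = 0} ->
  exists zs, [/\ path <%R z zs, size zs = size (rows ns) &
                 {in zs, forall y, derive1 g y = 0}].
Proof.
move=> dg; elim: ns z => [|[z' d] ns ih] z z0 /=; first by exists [::].
move=> /andP[zz' pz'] gz vg.
have z'0 : 0 < z' by apply: lt_trans zz'.
have gz' : g z' = 0.
  by apply: (vg (z', false)); rewrite /rows/= mem_cat; case: (d); rewrite !inE eqxx.
have [zs [pzs szs dzs]] : exists zs, [/\ path <%R z' zs, size zs = size (rows ns) &
                 {in zs, forall y, derive1 g y = 0}].
  apply: ih => // u uns; apply: vg.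
  by rewrite /rows/= mem_cat -/(rows ns) uns orbT.
have [||| y] := @Rolle R g z z' zz'.
- by move=> x; rewrite in_itv/= => /andP[zx _]; apply: dg; apply: lt_trans zx.
- apply: derivable_within_continuous => x; rewrite in_itv/= => /andP[zx _].
  by apply: dg; apply: lt_le_trans zx.
- by rewrite gz gz'.
rewrite in_itv/= => /andP[zy yz'] gy.
have dy : derive1 g y = 0 by rewrite derive1E derive_val.
exists (y :: (if d then z' :: zs else zs)); split.
- rewrite /= zy/=; case: (d) => /=; first by rewrite yz'.
  by apply: (@path_le _ <%R) pzs => //; exact: lt_trans.
- by rewrite /rows/= size_cat -/(rows ns); case: (d); rewrite /= szs.
- move=> w; rewrite inE => /predU1P[->//|].
  case: ifPn => dd; last exact: dzs.
  rewrite inE => /predU1P[->|]; last exact: dzs.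
  by apply: (vg (z', true)); rewrite /rows/= mem_cat dd !inE eqxx orbT.
Qed.

(** Each zero counted with multiplicity, differentiation loses at most one. *)
Lemma rolle_rows g ns :
  (forall x, 0 < x -> derivable g x 1) ->
  path <%R 0 [seq u.1 | u <- ns] ->
  {in rows ns, forall u, node_val g u = 0} ->
  exists zs, [/\ path <%R 0 zs, size zs = (size (rows ns)).-1 &
                 {in zs, forall y, derive1 g y = 0}].
Proof.
move=> dg; case: ns => [|[z d] ns]/=; first by exists [::].
move=> /andP[z0 pz] vg.
have [|||||zs [pzs szs dzs]] := @rolle_rows_from g z ns.
- exact: dg.
- exact: z0.
- exact: pz.
- by apply: (vg (z, false)); rewrite /rows/= mem_cat; case: (d); rewrite !inE eqxx.
- by move=> u uns; apply: vg; rewrite /rows/= mem_cat -/(rows ns) uns orbT.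
exists (if d then z :: zs else zs); split.
- case: (d); rewrite /= ?z0//.
  by apply: (@path_le _ <%R) pzs => //; exact: lt_trans.
- by rewrite /rows/= size_cat -/(rows ns); case: (d); rewrite /= szs.
- move=> w; case: ifPn => dd; last exact: dzs.
  rewrite inE => /predU1P[->|]; last exact: dzs.
  by apply: (vg (z, true)); rewrite /rows/= mem_cat dd !inE eqxx orbT.
Qed.

Lemma is_derive_gpoly n (al c : 'I_n -> R) (x : R) : 0 < x ->
  is_derive x 1 (gpoly al c) (gpoly (fun i => al i - 1) (fun i => c i * al i) x).
Proof.
move=> x0.
rewrite (_ : gpoly al c = \sum_i (fun t => c i * t `^ al i)); last first.
  by apply/funext => t; rewrite fct_sumE.
apply: is_derive_sum => i.
have := is_deriveZ (c i) (is_derive1_powR (al i) x0).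
by rewrite -[_ *: (_ * _)]/(_ * (_ * _)) mulrA.
Qed.

Lemma derivable_gpoly n (al c : 'I_n -> R) (x : R) : 0 < x -> derivable (gpoly al c) x 1.
Proof. by move=> /is_derive_gpoly H; apply: ex_derive. Qed.

Lemma derive1_gpoly n (al c : 'I_n -> R) (x : R) : 0 < x ->
  derive1 (gpoly al c) x = gpoly (fun i => al i - 1) (fun i => c i * al i) x.
Proof. by move=> x0; rewrite derive1E; have [_ ->] := is_derive_gpoly al c x0. Qed.

Lemma gpoly_shift n (al c : 'I_n -> R) (k x : R) : 0 < x ->
  gpoly (fun i => al i + k) c x = x `^ k * gpoly al c x.
Proof.
move=> x0; rewrite /gpoly mulr_sumr; apply: eq_bigr => i _.
by rewrite powRD ?(gt_eqF x0) ?implybT// mulrA mulrC.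
Qed.

(** Descartes-type bound: with n increasing exponents, only the zero function
    has n zeros on the half-line, double zeros counted twice.  Division by the
    lowest power turns one term into a constant, which differentiation kills,
    so that the induction loses one exponent and one zero at a time. *)
Lemma gpoly_zeros n (al c : 'I_n -> R) ns :
  (forall i j : 'I_n, (i < j)%N -> al i < al j) ->
  path <%R 0 [seq u.1 | u <- ns] -> (n <= size (rows ns))%N ->
  {in rows ns, forall u, node_val (gpoly al c) u = 0} ->
  forall i, c i = 0.
Proof.
elim: n al c ns => [|n ih] al c ns alinc pns sns vns; first by case.
have rpos u := rows_gt0 (u := u) pns.
pose be i := al i - al ord0.
have [||zs [pzs szs dzs]] := @rolle_rows (gpoly be c) ns _ pns.
- by move=> x; exact: derivable_gpoly.
- move=> [x d] xns; have /= x0 := rpos _ xns.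
  have fx : gpoly al c x = 0.
    by apply: (vns (x, false)); apply/mem_rows/(rows_fst xns).
  have bE : be = fun i => al i + (- al ord0) by [].
  have := vns _ xns; rewrite /node_val/=; case: (d); last first.
    by move=> _; rewrite bE gpoly_shift// fx mulr0.
  rewrite !derive1_gpoly// => dfx.
  have -> : gpoly (fun i => be i - 1) (fun i => c i * be i) x =
     x `^ (- al ord0) * gpoly (fun i => al i - 1) (fun i => c i * al i) x
     - al ord0 * x `^ (- al ord0 - 1) * gpoly al c x.
    rewrite -gpoly_shift// -mulrA -gpoly_shift// /gpoly mulr_sumr -sumrB.
    apply: eq_bigr => i _.
    have -> : al i - 1 - al ord0 = be i - 1 by rewrite /be addrAC.
    have -> : al i + (- al ord0 - 1) = be i - 1 by rewrite /be addrA.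
    by rewrite mulrBr mulrBl [al ord0 * _]mulrCA !mulrA.
  by rewrite dfx fx !mulr0 subr0.
have clift i : c (lift ord0 i) = 0.
  have := ih (fun i => be (lift ord0 i) - 1)
    (fun i => c (lift ord0 i) * be (lift ord0 i)) [seq (z, false) | z <- zs].
  move=> /(_ _ _ _ _ i) => /(_ _ _ _ _)/eqP.
  rewrite mulf_eq0 => H; have : be (lift ord0 i) != 0.
    by rewrite gt_eqF// subr_gt0 alinc.
  move=> /negPf bi; rewrite bi orbF in H; apply/eqP/H.
  - by move=> j k jk; rewrite !ltrD2r alinc// !lift0.
  - by rewrite -map_comp map_id_in.
  - by rewrite rows_single size_map szs; case: (size _) sns.
  - move=> u; rewrite rows_single => /mapP[z zzs ->]; rewrite /node_val/=.
    have z0 : 0 < z.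
      by move: pzs; rewrite (path_sortedE lt_trans) => /andP[/allP/(_ _ zzs)].
    have := dzs _ zzs; rewrite derive1_gpoly// /gpoly big_ord_recl.
    by rewrite {1 2}/be subrr mulr0 mul0r add0r.
have c0 : c ord0 = 0.
  case: ns {pzs dzs szs} pns sns vns rpos => [//|[x d] ns] _ _ vns rpos.
  have xin : (x, false) \in rows ((x, d) :: ns).
    by rewrite /rows/= mem_cat; case: (d); rewrite !inE eqxx.
  have /= x0 := rpos _ xin; have := vns _ xin; rewrite /node_val/= /gpoly.
  rewrite big_ord_recl big1 ?addr0; last by move=> i _; rewrite clift mul0r.
  by move=> /eqP; rewrite mulf_eq0 (gt_eqF (powR_gt0 _ x0)) orbF => /eqP.
by move=> i; case: (unliftP ord0 i) => [j ->|->].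
Qed.

End ZeroCount.

(** * Determinants of interpolation matrices *)

Definition ndet {R : realType} {n : nat} (al : 'I_n -> R) (s : seq (R * bool)) : R :=
  \det (node_mx (powers al) s).

(** The coefficients of the determinant as a function of its first row; the
    head of the list is a dummy, since cofactors ignore their own row. *)
Definition coef1 {R : realType} {n : nat} (al : 'I_n.+1 -> R) (s : seq (R * bool))
    (i : 'I_n.+1) : R :=
  cofactor (node_mx (powers al) ((0, false) :: s)) ord0 i.

Section NodeDet.
Context {R : realType}.
Implicit Types (ns s e : seq (R * bool)) (zs : seq R).

Lemma node_mxE n (g : 'I_n -> R -> R) s k i :
  node_mx g s k i = node_val (g i) (nth (0, false) s k).
Proof. by rewrite mxE. Qed.

Lemma node_val_gpoly n (al c : 'I_n -> R) (u : R * bool) : 0 < u.1 ->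
  node_val (gpoly al c) u = \sum_i c i * node_val (powers al i) u.
Proof.
case: u => x [] /= x0; rewrite /node_val//= derive1_gpoly//.
apply: eq_bigr => i _; rewrite powR_derive1 ?mulrA//.
by rewrite in_itv/= x0.
Qed.

(** A kernel vector of the matrix is the coefficient vector of a generalized
    polynomial with too many zeros. *)
Lemma ndet_neq0 n (al : 'I_n -> R) ns :
  (forall i j : 'I_n, (i < j)%N -> al i < al j) ->
  path <%R 0 [seq u.1 | u <- ns] -> size (rows ns) = n ->
  ndet al (rows ns) != 0.
Proof.
move=> alinc pns sns; rewrite /ndet -det_tr; apply/det0P => -[v v0 vM].
suff H i : v ord0 i = 0 by case/eqP: v0; apply/rowP => i; rewrite H mxE.
apply: (gpoly_zeros (al := al) (c := v ord0) (ns := ns)) => //.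
  by rewrite sns.
move=> u uns; rewrite node_val_gpoly ?(rows_gt0 pns uns)//.
have uk : (index u (rows ns) < n)%N by rewrite -sns index_mem.
have := congr1 (fun M : 'rV_n => M ord0 (Ordinal uk)) vM.
rewrite !mxE => vk; rewrite -[RHS]vk.
by apply: eq_bigr => j _; rewrite !mxE /= nth_index.
Qed.

Lemma ndet_swap n (al : 'I_n -> R) s1 s2 u v : ((size s1).+1 < n)%N ->
  ndet al (s1 ++ u :: v :: s2) = - ndet al (s1 ++ v :: u :: s2).
Proof.
move=> sn; pose i := Ordinal (ltnW sn); pose j := Ordinal sn.
have ij : i != j by rewrite -val_eqE/= neq_ltn ltnSn.
rewrite /ndet.
have -> : node_mx (powers al) (s1 ++ u :: v :: s2) =
          xrow i j (node_mx (powers al) (s1 ++ v :: u :: s2)).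
  apply/matrixP => k l; rewrite [RHS]mxE !node_mxE; congr (node_val _ _).
  case: perm.tpermP => [->|->|/eqP ki /eqP kj].
  - by rewrite !nth_cat/= ltnn subnn/= ltnNge leqnSn/= subSnn.
  - by rewrite !nth_cat/= ltnn subnn/= ltnNge leqnSn/= subSnn.
  - rewrite !nth_cat; case: ltnP => // sk.
    have : (size s1 < k)%N by rewrite ltn_neqAle sk andbT eq_sym.
    rewrite leq_eqVlt eq_sym -[_ == _]/(k == j) (negPf kj)/= => sk2.
    by have -> : (k - size s1 = (k - (size s1).+2).+2)%N by lia.
by rewrite xrowE det_mulmx /tperm_mx det_perm perm.odd_tperm ij expr1 mulN1r.
Qed.

Lemma ndet_move n (al : 'I_n -> R) s1 e s2 x : (size s1 + size e < n)%N ->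
  ndet al (s1 ++ x :: e ++ s2) = (-1) ^+ size e * ndet al (s1 ++ e ++ x :: s2).
Proof.
elim: e s1 => [|u e ih] s1 /= sn; first by rewrite mul1r.
rewrite ndet_swap; last by lia.
rewrite -cat_rcons ih ?size_rcons; last by lia.
by rewrite cat_rcons exprS !mulNr mul1r.
Qed.

Lemma ndet_row1 n (al : 'I_n.+1 -> R) u s :
  ndet al (u :: s) = \sum_i coef1 al s i * node_val (powers al i) u.
Proof.
rewrite /ndet (expand_det_row _ ord0); apply: eq_bigr => i _.
have -> : cofactor (node_mx (powers al) (u :: s)) ord0 i = coef1 al s i.
  by rewrite /coef1 /cofactor; congr (_ * \det _); apply/matrixP => k l; rewrite !mxE.
by rewrite node_mxE mulrC.
Qed.

Lemma ndet_cons_gpoly n (al : 'I_n.+1 -> R) x s :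
  ndet al ((x, false) :: s) = gpoly al (coef1 al s) x.
Proof. by rewrite ndet_row1. Qed.

Lemma ndet_cons_eq0 n (al : 'I_n -> R) u s : (size s < n)%N -> u \in s ->
  ndet al (u :: s) = 0.
Proof.
case: n al => // n al sn us.
have uk : ((index u s).+1 < n.+1)%N by apply: leq_trans sn; rewrite ltnS index_mem.
apply: (determinant_alternate (i1 := ord0) (i2 := Ordinal uk)) => // j.
by rewrite !node_mxE/= nth_index.
Qed.

(** Deleting the first row and the column of the largest exponent leaves a
    matrix of the same kind; the sign is the one that moves the first row to the
    end. *)
Lemma coef1_max n (al : 'I_n.+1 -> R) s :
  (-1) ^+ n * coef1 al s ord_max = ndet (al \o widen_ord (leqnSn n)) s.
Proof.
rewrite /coef1 /cofactor /= add0n mulrA -exprD addnn -mul2n exprM sqrrN expr1n.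
rewrite expr1n mul1r /ndet; congr (\det _); apply/matrixP => k l.
have -> : widen_ord (leqnSn n) = lift ord_max.
  by apply/funext => i; apply: val_inj; rewrite /= /bump leqNgt ltn_ord.
by rewrite 2!mxE !node_mxE.
Qed.

(** The term of largest exponent dominates at infinity.  With x = expR u, each
    quotient of a lower term by the leading power decays exponentially. *)
Lemma gpoly_pos n (al c : 'I_n.+1 -> R) (M : R) :
  (forall i j : 'I_n.+1, (i < j)%N -> al i < al j) -> 0 < c ord_max ->
  exists2 Y, M < Y & 0 < gpoly al c Y.
Proof.
move=> alinc c0.
have /cvgr_gt/(_ _ c0) : gpoly (fun i => al i - al ord_max) c (expR u) @[u --> +oo]
    --> c ord_max.
  have -> : c ord_max = \sum_(i < n.+1) (if i == ord_max then c ord_max else 0).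
    by rewrite (bigD1 ord_max)//= eqxx big1 ?addr0// => i /negPf->.
  rewrite /gpoly; apply: cvg_big => [|i _]; first exact: add_continuous.
  case: eqVneq => [->|imax].
    by under eq_fun do rewrite subrr powRr0 mulr1; exact: cvg_cst.
  have ai : 0 < al ord_max - al i.
    by rewrite subr_gt0 alinc// ltn_neqAle -ltnS ltn_ord andbT.
  rewrite -[X in _ --> X](mulr0 (c i)); apply: cvgMr.
  have -> : (fun u => expR u `^ (al i - al ord_max)) =
     (fun x => expR (- x)) \o (fun u => (al ord_max - al i) * u).
    apply/funext => u /=; rewrite /powR gt_eqF ?expR_gt0// expRK.
    by rewrite -mulNr opprB.
  by apply: cvg_comp; [apply: gt0_cvgMry => //; exact: cvg_id|exact: cvgr_expR].
move=> H.
have /filter_ex[u [/= Mu gu]] : \forall u \near +oo, M < expR u /\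
    0 < gpoly (fun i => al i - al ord_max) c (expR u).
  near=> u; split; last by near: u.
  have : M < u by near: u; apply: nbhs_pinfty_gt; exact: num_real.
  by move=> /lt_le_trans; apply; apply: le_trans (expR_ge1Dx u); rewrite lerDr.
exists (expR u) => //; move: gu.
by rewrite gpoly_shift ?expR_gt0// pmulr_rgt0// powR_gt0// expR_gt0.
Unshelve. all: by end_near. Qed.

End NodeDet.

(** * Total positivity *)

Section NodeDetPos.
Context {R : realType}.
Implicit Types (ns s e : seq (R * bool)) (zs : seq R).

Lemma derive1_ge0_right (g : R -> R) (z : R) : derivable g z 1 -> g z = 0 ->
  (forall y, z < y -> 0 < g y) -> 0 <= derive1 g z.
Proof.
move=> dg gz gpos; rewrite derive1E.
rewrite ['D_1 g z]cvg_at_rightE; last exact: dg.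
apply: limr_ge.
  rewrite -(cvg_at_rightE (fun h : R => h^-1 *: ((g \o shift z) _ - g z))) //.
  exact: (cvg_dnbhs_at_right dg).
near=> h.
have h0 : 0 < h by near: h; exact: nbhs_right_gt.
rewrite mulr_ge0 ?invr_ge0 ?(ltW h0)// gz subr0 ltW//=.
by apply: gpos; rewrite [_%:A]mulr1 ltrDr.
Unshelve. all: by end_near. Qed.

Lemma ndet_rcons n (al : 'I_n.+1 -> R) s u : size s = n -> 0 < u.1 ->
  ndet al (rcons s u) = node_val (gpoly al (fun i => (-1) ^+ n * coef1 al s i)) u.
Proof.
move=> sn u0; have := @ndet_move R n.+1 al [::] s [::] u.
rewrite /= add0n sn ltnSn => /(_ isT); rewrite cats0 cats1 => H.
rewrite node_val_gpoly//; under eq_bigr do rewrite -mulrA.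
rewrite -mulr_sumr -ndet_row1 H mulrA -exprD addnn -mul2n exprM sqrrN expr1n.
by rewrite expr1n mul1r.
Qed.

(** As a function of its last, simple node, the determinant does not vanish to
    the right of the other nodes, and its leading coefficient is a smaller
    positive determinant; hence it has the sign that it has at infinity. *)
Lemma ndet_gt0_single n (al : 'I_n.+1 -> R) ns z :
  (forall i j : 'I_n.+1, (i < j)%N -> al i < al j) ->
  path <%R 0 (rcons [seq u.1 | u <- ns] z) -> size (rows ns) = n ->
  0 < ndet (al \o widen_ord (leqnSn n)) (rows ns) ->
  0 < ndet al (rcons (rows ns) (z, false)).
Proof.
move=> alinc pz sn IH.
have z0 : 0 < z.
  by move: pz; rewrite lt_path_sortedE all_rcons => /andP[/andP[]].
have nz y : z <= y -> ndet al (rcons (rows ns) (y, false)) != 0.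
  move=> zy; have -> : rcons (rows ns) (y, false) = rows (rcons ns (y, false)).
    by rewrite -!cats1 rows_cat.
  apply: ndet_neq0 => //; last by rewrite -cats1 rows_cat size_cat sn addn1.
  move: pz; rewrite map_rcons !rcons_path => /andP[-> /=] lz.
  exact: lt_le_trans zy.
pose c i := (-1) ^+ n * coef1 al (rows ns) i.
have gE y : 0 < y -> ndet al (rcons (rows ns) (y, false)) = gpoly al c y.
  by move=> y0; rewrite ndet_rcons.
rewrite -coef1_max in IH.
have [Y zY gY] := gpoly_pos (c := c) z alinc IH.
rewrite lt_neqAle eq_sym nz//= leNgt; apply/negP => lt0.
have [||w] := @IVT R (gpoly al c) z Y 0 (ltW zY).
- apply: derivable_within_continuous => x; rewrite in_itv/= => /andP[zx _].
  by apply: derivable_gpoly; apply: lt_le_trans zx.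
- by rewrite -gE// ge_min (ltW lt0)/= le_max (ltW gY) orbT.
- rewrite in_itv/= => /andP[zw _] gw; have := nz _ zw.
  by rewrite gE ?gw ?eqxx//; apply: lt_le_trans zw.
Qed.

(** A last double node at z is the derivative at y = z of the determinant with
    simple nodes z < y: this function is zero at z and positive to the right of
    it, so that the derivative is nonnegative, and it is nonzero by the zero
    count. *)
Lemma ndet_gt0 n (al : 'I_n -> R) ns :
  (forall i j : 'I_n, (i < j)%N -> al i < al j) ->
  path <%R 0 [seq u.1 | u <- ns] -> size (rows ns) = n ->
  0 < ndet al (rows ns).
Proof.
elim: n al ns => [|n ih] al ns alinc pns sns.
  by rewrite /ndet det_mx00 ltr01.
have alinc' (i j : 'I_n) : (i < j)%N ->
  (al \o widen_ord (leqnSn n)) i < (al \o widen_ord (leqnSn n)) j.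
  by move=> ij; exact: alinc.
case/lastP: ns pns sns => [//|ns [z d]].
rewrite map_rcons => /= pz; rewrite -cats1 rows_cat size_cat /=.
case: d => /=; rewrite ?addn1 ?addn2 => -[sn]; last first.
  by rewrite cats1; apply: ndet_gt0_single => //; apply: ih => //;
    move: pz; rewrite rcons_path => /andP[].
have z0 : 0 < z.
  by move: pz; rewrite lt_path_sortedE all_rcons => /andP[/andP[]].
pose s1 := rows (rcons ns (z, false)).
have s1E : s1 = rcons (rows ns) (z, false) by rewrite /s1 -!cats1 rows_cat.
have ss1 : size s1 = n by rewrite s1E size_rcons.
have -> : rows ns ++ rows [:: (z, true)] = rcons s1 (z, true).
  by rewrite s1E -!cats1 -catA.
have nz : ndet al (rcons s1 (z, true)) != 0.
  have -> : rcons s1 (z, true) = rows (rcons ns (z, true)).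
    by rewrite s1E -!cats1 rows_cat -catA.
  apply: ndet_neq0 => //; first by rewrite map_rcons.
  by rewrite -cats1 rows_cat size_cat/= addn2 sn.
rewrite lt_neqAle eq_sym nz/= ndet_rcons// /node_val/=.
apply: derive1_ge0_right.
- exact: derivable_gpoly.
- rewrite -[LHS]/(node_val (gpoly al _) (z, false)) -ndet_rcons//.
  have := @ndet_move R n.+1 al [::] s1 [::] (z, false).
  rewrite /= add0n ss1 ltnSn => /(_ isT); rewrite cats0 cats1.
  rewrite ndet_cons_eq0 ?ss1 ?ltnS//; last by rewrite s1E mem_rcons inE eqxx.
  by move=> /esym/eqP; rewrite mulf_eq0 signr_eq0/= => /eqP.
- move=> y zy; have y0 : 0 < y by exact: lt_trans zy.
  rewrite -[ltRHS]/(node_val (gpoly al _) (y, false)) -ndet_rcons//.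
  apply: ndet_gt0_single => //.
    by rewrite map_rcons rcons_path pz/= last_rcons.
  by apply: ih => //; rewrite map_rcons.
Qed.

End NodeDetPos.

(** * Sign of the determinant with a free first row *)

Section Sign.
Context {R : realType}.
Implicit Types (ns s e : seq (R * bool)) (xs ys zs : seq R).

Lemma odd_size_rows ns : odd (size (rows ns)) = odd (count (fun u => ~~ u.2) ns).
Proof.
elim: ns => [//|[z d] ns ih]; rewrite rows_cons/= size_cat size_nseq !oddD ih.
by case: d; rewrite /= ?negbK.
Qed.

(** Moving the row of x to its place among the nodes passes two rows for each
    double node and one row for each simple node below x. *)
Lemma ndet_cons_gt0 n (al : 'I_n.+1 -> R) ns (x : R) :
  (forall i j : 'I_n.+1, (i < j)%N -> al i < al j) ->
  path <%R 0 [seq u.1 | u <- ns] -> size (rows ns) = n ->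
  0 < x -> x \notin [seq u.1 | u <- ns] ->
  0 < (-1) ^+ count (fun u => ~~ u.2 && (u.1 < x)) ns * ndet al ((x, false) :: rows ns).
Proof.
move=> alinc pns sns x0 xns.
have [ns1 [ns2 [nsE lt1 lt2]]] : exists ns1 ns2, [/\ ns = ns1 ++ ns2,
    all (fun u => u.1 < x) ns1 & path <%R x [seq u.1 | u <- ns2]].
  elim: ns {sns} 0 x0 pns xns => [|[z d] ns ih] c cx /=; first by exists [::], [::].
  move=> /andP[cz pz]; rewrite inE negb_or => /andP[xz xns].
  case: (ltP z x) => zx.
    have [ns1 [ns2 [-> lt1 lt2]]] := ih z zx pz xns.
    by exists ((z, d) :: ns1), ns2; rewrite /= zx.
  by exists [::], ((z, d) :: ns); split => //=; rewrite pz lt_neqAle xz zx.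
rewrite nsE rows_cat in sns pns *.
have -> : count (fun u => ~~ u.2 && (u.1 < x)) (ns1 ++ ns2) = count (fun u => ~~ u.2) ns1.
  rewrite count_cat [X in (_ + X)%N](_ : _ = 0%N) ?addn0.
    by apply: eq_in_count => u /(allP lt1)->; rewrite andbT.
  apply/eqP; rewrite -leqn0 leqNgt -has_count; apply/hasPn => u uns2.
  move: lt2; rewrite lt_path_sortedE => /andP[/allP/(_ u.1)+ _].
  by rewrite map_f// => /(_ isT) xu; rewrite negb_and -leNgt (ltW xu) orbT.
rewrite -signr_odd -odd_size_rows signr_odd.
have s1n : (0 + size (rows ns1) < n.+1)%N by rewrite -sns size_cat ltnS leq_addr.
rewrite (@ndet_move R n.+1 al [::] (rows ns1) (rows ns2) (x, false) s1n).
rewrite mulrA -exprD addnn -mul2n exprM sqrrN expr1n expr1n mul1r.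
have -> : rows ns1 ++ (x, false) :: rows ns2 = rows (ns1 ++ (x, false) :: ns2).
  by rewrite rows_cat.
apply: ndet_gt0 => //.
  move: pns; rewrite !map_cat !cat_path /= => /andP[-> _]; rewrite lt2 andbT.
  have := mem_last 0 [seq u.1 | u <- ns1]; rewrite inE => /predU1P[->//|].
  by move=> /mapP[u uns1 ->]; exact: (allP lt1).
by rewrite rows_cat !size_cat addnS -size_cat sns.
Qed.

Lemma path_itv (a b : R) xs x : path <%R a (rcons xs b) -> x \in xs -> a < x < b.
Proof.
rewrite lt_path_sortedE all_rcons -cats1 (sorted_pairwise lt_trans) pairwise_cat.
rewrite allrel1r => /andP[/andP[_ /allP ax] /and3P[/allP xb _ _]] xin.
by rewrite ax//; exact: xb.
Qed.

Lemma path_uniq (a b : R) xs : path <%R a (rcons xs b) -> uniq xs.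
Proof.
rewrite rcons_path => /andP[/path_sorted + _].
exact: (sorted_uniq lt_trans ltxx).
Qed.

(** Once sorted, the list is filled up by midpoints between a and its first
    element. *)
Lemma extend_points (a b : R) xs m : a < b ->
  {in xs, forall x, a < x < b} -> uniq xs -> (size xs <= m)%N ->
  exists ys, [/\ path <%R a (rcons ys b), size ys = m & {subset xs <= ys}].
Proof.
move=> ab xab uxs sm.
pose zs := sort <=%R xs.
have szs : size zs = size xs by rewrite size_sort.
have pzs : path <%R a (rcons zs b).
  rewrite lt_path_sortedE all_rcons ab/=; apply/andP; split.
    by apply/allP => x; rewrite mem_sort => /xab/andP[].
  have : sorted <%R zs by rewrite lt_sorted_uniq_le sort_uniq uxs sort_le_sorted.
  have : {in zs, forall x, x < b} by move=> x; rewrite mem_sort => /xab/andP[].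
  case: {szs} zs => //= z zs zb pz; rewrite rcons_path pz/=.
  by apply: zb; exact: mem_last.
have xzs : {subset xs <= zs} by move=> x; rewrite mem_sort.
rewrite -szs in sm; rewrite -(subnK sm); elim: (m - _)%N => [|k [ys [pys sys xys]]].
  by exists zs.
pose c := head b ys; have ac : a < c.
  by move: pys; rewrite /c; case: (ys) => [|y ys'] /= /andP[].
exists ((a + c) / 2 :: ys); split; last by move=> x /xys xin; rewrite inE xin orbT.
  rewrite /= midf_lt//= (_ : path _ _ _ = path <%R ((a + c) / 2) (rcons ys b))//.
  by move: pys ac; rewrite /c; case: (ys) => [|y ys'] /= /andP[_ pb] ac;
    rewrite midf_lt//= pb.
by rewrite /= sys addSn.
Qed.

End Sign.

(** * The nodes of the special polynomials *)

Section SpecialNodes.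
Context {R : realType}.

(** The flag ea says whether the left endpoint is a node, and eb whether the
    right one is a node, and a double one.  A double node at b occurs in none of
    the given polynomials but in limits of them. *)
Definition special_nodes (ea : bool) (a : R) (ys : seq R) (eb : option bool) (b : R) :=
  (if ea then [:: (a, false)] else [::]) ++ [seq (y, true) | y <- ys] ++
  (if eb is Some d then [:: (b, d)] else [::]).

Lemma special_points ea (a : R) ys eb b :
  [seq u.1 | u <- special_nodes ea a ys eb b] =
  (if ea then [:: a] else [::]) ++ ys ++ (if eb is Some _ then [:: b] else [::]).
Proof.
by rewrite !map_cat -map_comp map_id_in//; case: ea; case: eb.
Qed.

Lemma special_rows ea (a : R) ys eb b : rows (special_nodes ea a ys eb b) =
  (if ea then single a else [::]) ++ doubles ys ++
  (if eb is Some d then if d then [:: (b, false); (b, true)] else single b else [::]).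
Proof. by rewrite !rows_cat rows_double; case: ea; case: eb => [[]|]. Qed.

Lemma size_special_rows ea (a : R) ys eb b :
  size (rows (special_nodes ea a ys eb b)) =
  (ea + (size ys).*2 + (if eb is Some d then d.+1 else 0))%N.
Proof.
rewrite special_rows !size_cat size_doubles addnA.
by case: ea; case: eb => [[]|].
Qed.

Lemma special_path ea (a : R) ys eb b : 0 < a -> path <%R a (rcons ys b) ->
  path <%R 0 [seq u.1 | u <- special_nodes ea a ys eb b].
Proof.
move=> a0 pys; rewrite special_points.
have p1 : path <%R a (ys ++ (if eb is Some _ then [:: b] else [::])).
  case: eb => [_|]; first by rewrite cats1.
  by move: pys; rewrite cats0 rcons_path => /andP[].
case: ea => /=; first by rewrite a0.
by apply: (@path_le _ <%R) p1 => //; exact: lt_trans.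
Qed.

Lemma special_sign ea (a : R) ys eb b x : a <= x <= b ->
  x \notin [seq u.1 | u <- special_nodes ea a ys eb b] ->
  count (fun u => ~~ u.2 && (u.1 < x)) (special_nodes ea a ys eb b) = ea.
Proof.
move=> /andP[ax xb] xns; rewrite !count_cat.
have -> : count (fun u => ~~ u.2 && (u.1 < x)) [seq (y, true) | y <- ys] = 0%N.
  by rewrite count_map; elim: ys {xns}.
rewrite [X in (_ + (_ + X))%N](_ : _ = 0%N); last first.
  by case: eb {xns} => [d|//] /=; rewrite ltNge xb andbF.
move: xns; rewrite special_points; case: ea => //=; rewrite inE negb_or => /andP[xa _].
by rewrite lt_neqAle eq_sym xa ax.
Qed.

End SpecialNodes.

(** * The space of generalized polynomials as a Chebyshev system *)

Section LinPowers.
Context {R : realType} {n : nat} (al : 'I_n.+1 -> R).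
Hypothesis alinc : forall i j : 'I_n.+1, (i < j)%N -> al i < al j.
Local Notation V := (lin (powers al)).
Implicit Types (p q : V) (x : R).

Lemma lin_addE p q x : (p + q) x = p x + q x. Proof. by []. Qed.
Lemma lin_scaleE k p x : (k *: p) x = k * p x. Proof. by []. Qed.
Lemma lin_oppE p x : (- p) x = - p x. Proof. by []. Qed.
Lemma lin_zeroE x : (0 : V) x = 0. Proof. by []. Qed.

Lemma lin_sumE I (r : seq I) (P : pred I) (F : I -> V) x :
  (\sum_(i <- r | P i) F i) x = \sum_(i <- r | P i) F i x.
Proof. by elim/big_rec2: _ => // i y q _ <-. Qed.

Lemma lin_ext p q : (forall x, p x = q x) -> p = q.
Proof. by move=> pq; apply: val_inj; apply/funext. Qed.

Lemma lin_coefs p : exists c, forall x, p x = gpoly al c x.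
Proof.
case: p => f /= /asboolP[c ->]; exists c => x.
by rewrite fct_sumE.
Qed.

Lemma gpoly_lin c : exists p, forall x, p x = gpoly al c x.
Proof.
have H : (fun x => gpoly al c x) \in in_lin (powers al).
  by apply/asboolP; exists c; apply/funext => x; rewrite fct_sumE.
by exists (Lin H).
Qed.

Lemma pos_lin : exists p, forall x, 0 < x -> 0 < p x.
Proof.
have [p pE] := gpoly_lin (fun i => (i == ord0)%:R); exists p => x x0.
rewrite pE /gpoly (bigD1 ord0)//= mul1r big1 ?addr0 ?powR_gt0//.
by move=> i /negPf->; rewrite mul0r.
Qed.

Lemma lin_within_continuous p (a b : R) : 0 < a -> {within `[a, b], continuous p}.
Proof.
move=> a0; have [c pE] := lin_coefs p.
rewrite (_ : lin_fun p = gpoly al c); last exact/funext.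
apply: derivable_within_continuous => x; rewrite in_itv/= => /andP[ax _].
by apply: derivable_gpoly; exact: lt_le_trans ax.
Qed.

Lemma lin_eq0 p ns : path <%R 0 [seq u.1 | u <- ns] -> (n < size (rows ns))%N ->
  {in rows ns, forall u, node_val p u = 0} -> p = 0.
Proof.
move=> pns sns; have [c pE] := lin_coefs p.
rewrite (_ : lin_fun p = gpoly al c); last exact/funext.
move=> /(gpoly_zeros alinc pns sns) c0; apply: lin_ext => x.
by rewrite pE lin_zeroE /gpoly big1// => i _; rewrite c0 mul0r.
Qed.

Lemma interpolation (ts : seq R) (y : R -> R) : path <%R 0 ts -> size ts = n.+1 ->
  exists p, {in ts, forall t, p t = y t}.
Proof.
move=> pts sts; pose ns := [seq (t, false) | t <- ts].
have ptns : path <%R 0 [seq u.1 | u <- ns] by rewrite -map_comp map_id_in.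
have sns : size (rows ns) = n.+1 by rewrite rows_single size_map.
have := ndet_neq0 alinc ptns sns; rewrite /ndet -unitfE -/(unitmx _) => Vu.
set A := node_mx _ _ in Vu.
pose v : 'cV[R]_n.+1 := \col_k y (nth 0 ts k).
have [p pE] := gpoly_lin (fun i => (invmx A *m v) i ord0).
exists p => t tts; have tk : (index t ts < n.+1)%N by rewrite -sts index_mem.
have := congr1 (fun M : 'cV_n.+1 => M (Ordinal tk) ord0) (mulKVmx Vu v).
rewrite !mxE/= nth_index// => <-; rewrite pE /gpoly.
apply: eq_bigr => i _; rewrite mulrC; congr (_ * _).
rewrite node_mxE/= rows_single (nth_map 0) ?nth_index ?sts//.
Qed.

(** Fewer than n + 1 points are completed by points of a larger interval, which
    leaves room even if both endpoints of [a, b] are among them. *)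
Lemma interpolation_sub (a b : R) (zs : seq R) (y : R -> R) : 0 < a -> a < b ->
  {in zs, forall z, a <= z <= b} -> uniq zs -> (size zs <= n.+1)%N ->
  exists p, {in zs, forall t, p t = y t}.
Proof.
move=> a0 ab zab uzs szs.
have [||ts [pts sts zts]] := @extend_points R (a / 2) (b + 1) zs n.+1 _ _ uzs szs.
- by rewrite (@lt_trans _ _ a)//; [lra|rewrite ltr_wpDr].
- by move=> z /zab /andP[az zb]; apply/andP; split; lra.
have [|p pE] := @interpolation ts y _ sts; last by exists p => t /zts; exact: pE.
move: pts; rewrite rcons_path => /andP[+ _].
by apply: path_le; [exact: lt_trans|rewrite divr_gt0].
Qed.

End LinPowers.

(** * Minimizing the functional over the nonnegative elements *)

Section Minimizer.
Context {R : realType} {n : nat} (al : 'I_n.+1 -> R).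
Hypothesis alinc : forall i j : 'I_n.+1, (i < j)%N -> al i < al j.
Variables (a b : R).
Hypotheses (a_gt0 : 0 < a) (ab : a < b).
Local Notation V := (lin (powers al)).
Variable L : {scalar V}.
Variable ts : seq R.
Hypotheses (pts : path <%R a (rcons ts b)) (sts : size ts = n.+1).

Lemma ts_path0 : path <%R 0 ts.
Proof.
move: pts; rewrite rcons_path => /andP[+ _].
by apply: path_le; [exact: lt_trans|].
Qed.

Lemma lin_ts_eq0 (p : V) : {in ts, forall t, p t = 0} -> p = 0.
Proof.
move=> p0; apply: (lin_eq0 alinc (ns := [seq (t, false) | t <- ts])).
- by rewrite -map_comp map_id_in//; exact: ts_path0.
- by rewrite rows_single size_map sts.
- by move=> u; rewrite rows_single => /mapP[t tts ->]; exact: p0.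
Qed.

Definition nonneg_on (p : V) := forall x, a <= x <= b -> 0 <= p x.
(** Strictly positive on nonzero nonnegative elements, as ts has n + 1 points:
    the functional used to normalize them. *)
Definition total (p : V) : R := \sum_(t <- ts) p t.

Lemma total_ge0 p : nonneg_on p -> 0 <= total p.
Proof.
move=> p0; rewrite /total big_seq; apply: sumr_ge0 => t /(path_itv pts)/andP[at_ tb].
by apply: p0; rewrite !ltW.
Qed.

Lemma total_eq0 p : nonneg_on p -> total p = 0 -> p = 0.
Proof.
move=> p0 /eqP; rewrite /total big_seq psumr_eq0; last first.
  by move=> t /(path_itv pts)/andP[at_ tb]; apply: p0; rewrite !ltW.
move=> /allP H; apply: lin_ts_eq0 => t tts.
by have /implyP/(_ tts)/eqP := H _ tts.
Qed.

(** In the coordinates p t, for t in ts, the normalized nonnegative elements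
    form a closed subset of a cube, so that L attains its minimum there. *)
Lemma minimizer : exists p : V, [/\ nonneg_on p, total p = 1 &
  forall q, nonneg_on q -> L p * total q <= L q].
Proof.
have nthts (j : 'I_n.+1) : nth 0 ts j \in ts by rewrite mem_nth// sts.
have /choice[q qE] : forall j : 'I_n.+1, exists q : V,
    {in ts, forall t, q t = (t == nth 0 ts j)%:R}.
  by move=> j; have [q qE] := interpolation alinc
    (fun t => (t == nth 0 ts j)%:R) ts_path0 sts; exists q.
have uts : uniq ts := path_uniq pts.
have decomp (p : V) : p = \sum_(j < n.+1) p (nth 0 ts j) *: q j.
  apply/eqP; rewrite -subr_eq0; apply/eqP; apply: lin_ts_eq0 => t tts.
  rewrite lin_addE lin_oppE lin_sumE.
  have tk : (index t ts < n.+1)%N by rewrite -sts index_mem.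
  rewrite (bigD1 (Ordinal tk))// big1 ?addr0; last first.
    move=> j jt; rewrite lin_scaleE qE// -[X in X == _](nth_index 0 tts).
    by rewrite nth_uniq ?sts// eq_sym [_ == _](negPf jt) mulr0.
  by rewrite lin_scaleE qE//= nth_index// eqxx mulr1 addr0 subrr.
pose comb (v : 'rV[R]_n.+1) : V := \sum_j v ord0 j *: q j.
have totalE (p : V) : total p = \sum_(j < n.+1) p (nth 0 ts j).
  by rewrite /total (big_nth 0) big_mkord sts.
have comb_nth v (j : 'I_n.+1) : comb v (nth 0 ts j) = v ord0 j.
  rewrite lin_sumE (bigD1 j)// big1 ?addr0; last first.
    by move=> k kj; rewrite lin_scaleE qE ?nthts// nth_uniq ?sts// eq_sym [_ == _](negPf kj) mulr0.
  by rewrite lin_scaleE qE ?nthts// eqxx mulr1; exact: addr0.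
have lincont (f : 'I_n.+1 -> R) : continuous (fun v : 'rV[R]_n.+1 => \sum_j v ord0 j * f j).
  move=> v; apply: (@cvg_big _ _ _ _ _ add_continuous _ _ _ _ _ (nbhs_filter v)) => j _.
  by apply: cvgMl; exact: coord_continuous.
pose K := [set v : 'rV[R]_n.+1 | [/\ forall j, `[0, 1]%classic (v ord0 j),
   \sum_j v ord0 j * 1 = 1 & forall x, a <= x <= b -> 0 <= \sum_j v ord0 j * q j x]].
have combE v x : comb v x = \sum_j v ord0 j * q j x by rewrite lin_sumE.
have cK : compact K.
  apply: (@subclosed_compact _ _ [set v : 'rV[R]_n.+1 | forall j, `[0, 1]%classic (v ord0 j)]).
  - rewrite (_ : K = [set v : 'rV[R]_n.+1 | forall j, `[0, 1]%classic (v ord0 j)] `&`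
      ((fun v : 'rV[R]_n.+1 => \sum_j v ord0 j * 1) @^-1` [set 1] `&`
      \bigcap_(x in `[a, b]) ((fun v : 'rV[R]_n.+1 => \sum_j v ord0 j * q j x) @^-1` [set y | 0 <= y]))).
      apply: closedI.
        rewrite (_ : mkset _ = \bigcap_(j in setT)
            ((fun v : 'rV[R]_n.+1 => v ord0 j) @^-1` `[0, 1]%classic)).
          apply: closed_bigI => j _; apply: closed_comp; last exact: itv_closed.
          by move=> v _; exact: coord_continuous.
        by apply/seteqP; split => [v vj j _|v vj j]; exact: vj.
      apply: closedI; first by apply: closed_comp => [v _|]; [exact: lincont|exact: closed_eq].
      apply: closed_bigI => x _; apply: closed_comp => [v _|]; first exact: (lincont (fun j => q j x)).
      exact: closed_ge.
    apply/seteqP; split => v.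
      move=> [v1 v2 v3]; split; first exact: v1.
      split; first exact: v2.
      by move=> x; rewrite /= in_itv /= => xab; exact: v3.
    move=> [v1 [v2 v3]]; split; [exact: v1|exact: v2|] => x xab.
    by apply: v3; rewrite /= in_itv.
  - exact: (@rV_compact R n.+1 (fun=> `[0, 1]%classic) (fun=> @segment_compact R 0 1)).
  - by move=> v [].
have inK (p : V) : nonneg_on p -> total p = 1 -> K (\row_j p (nth 0 ts j)).
  move=> p0 p1.
  have pj (j : 'I_n.+1) : 0 <= p (nth 0 ts j).
    by have /andP[? ?] := path_itv pts (nthts j); apply: p0; rewrite !ltW.
  split.
  - move=> j; rewrite mxE /= in_itv/= pj/= -p1 totalE (bigD1 j)//= lerDl.
    exact: sumr_ge0.
  - rewrite -[RHS]p1 totalE; apply: eq_bigr => j _; by rewrite mxE mulr1.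
  - move=> x xab; under eq_bigr do rewrite mxE.
    suff -> : \sum_(j < n.+1) p (nth 0 ts j) * q j x = p x by exact: p0.
    by rewrite [in RHS](decomp p) lin_sumE.
have K0 : K !=set0.
  have [p p0] := pos_lin al.
  have pn : nonneg_on p by move=> x /andP[ax _]; apply/ltW/p0; exact: lt_le_trans ax.
  have tp : 0 < total p.
    rewrite lt_neqAle total_ge0// andbT eq_sym; apply/negP => /eqP/(total_eq0 pn) pz.
    by have := p0 1 ltr01; rewrite pz lin_zeroE ltxx.
  exists (\row_j ((total p)^-1 *: p) (nth 0 ts j)); apply: inK.
    by move=> x xab; rewrite lin_scaleE mulr_ge0 ?pn// invr_ge0 ltW.
  rewrite /total; under eq_bigr do rewrite lin_scaleE.
  by rewrite -mulr_sumr mulVf// gt_eqF.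
have [v vK vmin] := @EVT_min_rV R _ (fun v => \sum_j v ord0 j * L (q j)) K K0 cK
  (continuous_subspaceT (lincont _)).
have LE (w : 'rV[R]_n.+1) : \sum_j w ord0 j * L (q j) = L (comb w).
  by rewrite /comb linear_sum; apply: eq_bigr => j _; rewrite linearZ.
move: vK; rewrite inE => -[v1 v2 v3].
exists (comb v); split.
- by move=> x xab; rewrite combE; exact: v3.
- by rewrite totalE -[RHS]v2; apply: eq_bigr => j _; rewrite comb_nth mulr1.
- move=> p pn; have [tp|tp] := eqVneq (total p) 0.
    by rewrite tp (total_eq0 pn tp) mulr0 linear0.
  have tp0 : 0 < total p by rewrite lt_neqAle eq_sym tp total_ge0.
  rewrite -ler_pdivlMr// mulrC.
  pose p' := (total p)^-1 *: p.
  have Kp : K (\row_j p' (nth 0 ts j)).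
    apply: inK.
      by move=> x xab; rewrite lin_scaleE mulr_ge0 ?pn// invr_ge0 ltW.
    rewrite /total; under eq_bigr do rewrite lin_scaleE.
    by rewrite -mulr_sumr mulVf.
  have := vmin _ (mem_set Kp); rewrite !LE.
  suff -> : comb (\row_j p' (nth 0 ts j)) = p' by rewrite /p' linearZ.
  by rewrite [RHS]decomp; apply: eq_bigr => j _; rewrite mxE.
Qed.

End Minimizer.

(** * Contact points of the minimizer *)

(** Here M stands for L minus its minimum times the normalizing functional; it
    is nonnegative on nonnegative elements and vanishes at the minimizer p. *)
Section Touching.
Context {R : realType} {n : nat} (al : 'I_n.+1 -> R).
Hypothesis alinc : forall i j : 'I_n.+1, (i < j)%N -> al i < al j.
Variables (a b : R).
Hypotheses (a_gt0 : 0 < a) (ab : a < b).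
Local Notation V := (lin (powers al)).
Variable M : {scalar V}.
Hypothesis M_ge0 : forall q : V, nonneg_on a b q -> 0 <= M q.
Variable p : V.
Hypotheses (p_ge0 : nonneg_on a b p) (Mp : M p = 0).

(** If q is positive at the zeros of p, then p + eps q is nonnegative for small
    eps > 0, because max(p, q) is bounded below by a positive constant. *)
Lemma touch_gt0 (q : V) : (forall x, a <= x <= b -> p x = 0 -> 0 < q x) -> 0 <= M q.
Proof.
move=> qpos.
have cp := lin_within_continuous (p := p) (b := b) a_gt0.
have cq := lin_within_continuous (p := q) (b := b) a_gt0.
have [c cab cmin] := @EVT_min R (fun x => Num.max (p x) (q x)) a b (ltW ab)
  (fun x => continuous_max (cp x) (cq x)).
have [d dab dmax] := @EVT_max R (fun x => - q x) a b (ltW ab)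
  (fun x => continuousN (cq x)).
set m := Num.max (p c) (q c) in cmin.
have m0 : 0 < m.
  rewrite in_itv/= in cab; rewrite /m lt_max.
  have := p_ge0 cab; rewrite le_eqVlt => /predU1P[/esym/qpos->//|->//].
  by rewrite orbT.
pose B := `|q d| + 1; have B0 : 0 < B by rewrite /B ltr_pwDr.
have qB x : a <= x <= b -> - q x <= B.
  move=> xab; apply: (le_trans (dmax x _)); first by rewrite in_itv.
  by rewrite /B (le_trans (ler_norm _))// normrN lerDl.
pose eps := m / B; have eps0 : 0 < eps by rewrite /eps divr_gt0.
have : 0 <= M (p + eps *: q).
  apply: M_ge0 => x xab; rewrite lin_addE lin_scaleE.
  have [q0|q0] := leP 0 (q x).
    by rewrite addr_ge0 ?p_ge0// mulr_ge0// ltW.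
  have mp : m <= p x.
    have := cmin x; rewrite in_itv/= xab => /(_ isT); rewrite le_max => /orP[//|mq].
    by have := lt_le_trans m0 mq; rewrite ltNge (ltW q0).
  have : eps * - q x <= eps * B by rewrite ler_pM2l// qB.
  rewrite /eps divfK ?gt_eqF// -/eps mulrN => h.
  by rewrite -[eps * _]opprK subr_ge0 (le_trans h).
by rewrite linearD linearZ Mp add0r /= pmulr_rge0.
Qed.

(** Adding a small multiple of a positive element makes q positive at the zeros
    of p. *)
Lemma touch_ge0 (q : V) : (forall x, a <= x <= b -> p x = 0 -> 0 <= q x) -> 0 <= M q.
Proof.
move=> q0; have [r r0] := pos_lin al.
have Mr : 0 <= M r.
  by apply: M_ge0 => x /andP[ax _]; apply/ltW/r0; exact: lt_le_trans ax.
apply/ler_addgt0Pl => e e0; pose d := e / (M r + 1).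
have Mr1 : 0 < M r + 1 by rewrite ltr_wpDl.
have d0 : 0 < d by rewrite divr_gt0.
have : 0 <= M (q + d *: r).
  apply: touch_gt0 => x xab px; rewrite lin_addE lin_scaleE.
  rewrite ltr_wpDl ?q0// mulr_gt0// r0//.
  by case/andP: xab => ax _; exact: lt_le_trans ax.
rewrite linearD linearZ /= => /le_trans; apply; rewrite addrC lerD2r.
by rewrite /d mulrAC ler_pdivrMr// ler_pM2l// lerDl.
Qed.

Lemma touch_eq0 (q : V) : (forall x, a <= x <= b -> p x = 0 -> q x = 0) -> M q = 0.
Proof.
move=> q0; apply/eqP; rewrite eq_le; apply/andP; split; last first.
  by apply: touch_ge0 => x xab px; rewrite q0.
rewrite -oppr_ge0 -linearN; apply: touch_ge0 => x xab px.
by rewrite lin_oppE q0 ?oppr0.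
Qed.

(** As M q depends only on the values of q at the zeros of p, interpolation at
    these zeros writes M as a combination of point evaluations, and the weights
    are the values of M at elements that are nonnegative there. *)
Lemma touch_repr (zs : seq R) : uniq zs -> (size zs <= n.+1)%N ->
  {in zs, forall z, a <= z <= b} ->
  (forall x, a <= x <= b -> p x = 0 -> x \in zs) ->
  exists w : R -> R, (forall z, 0 <= w z) /\
    (forall q : V, M q = \sum_(z <- zs) w z * q z).
Proof.
move=> uzs szs zab pzs.
have /choice[e eE] : forall y : R, exists e : V,
    {in zs, forall z, e z = (z == y)%:R}.
  by move=> y; exact: (interpolation_sub alinc (fun z => (z == y)%:R) a_gt0 ab zab uzs szs).
exists (fun z => M (e z)); split=> [z|q].
  by apply: touch_ge0 => x xab /(pzs _ xab) xzs; rewrite eE// ler0n.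
have /eqP : M (q - \sum_(z <- zs) q z *: e z) = 0.
  apply: touch_eq0 => x xab /(pzs _ xab) xzs.
  rewrite lin_addE lin_oppE lin_sumE (bigD1_seq x)// big1_seq.
    by rewrite lin_scaleE eE//= eqxx mulr1 addr0 subrr.
  by move=> z /andP[zx _]; rewrite lin_scaleE eE// eq_sym (negPf zx) mulr0.
rewrite linearB subr_eq0 => /eqP->; rewrite linear_sum.
by apply: eq_bigr => z _; rewrite linearZ mulrC.
Qed.

Hypothesis p_neq0 : p != 0.

(** Interior zeros of a nonnegative function are at least double. *)
Lemma zero_index (xs : seq R) : path <%R a (rcons xs b) ->
  {in xs, forall x, p x = 0} ->
  ((p a == 0%R) + (size xs).*2 + (p b == 0%R) <= n)%N.
Proof.
move=> pxs xs0; rewrite leqNgt; apply/negP => nlt.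
pose ns := special_nodes (p a == 0) a xs (if p b == 0 then Some false else None) b.
case/eqP: p_neq0; apply: (lin_eq0 alinc (ns := ns)).
- exact: special_path.
- by move: nlt; rewrite size_special_rows; case: (p b == 0).
- move=> u; rewrite special_rows !mem_cat => /or3P[].
  + by case: ifP => //= /eqP pa; rewrite inE => /eqP->.
  + move=> /flattenP[s /mapP[x xin ->]]; rewrite !inE => /orP[] /eqP->.
      exact: xs0.
    rewrite /node_val/= derive1E.
    have xsab := path_itv pxs xin.
    have [|||_ ->//] := @derive1_at_min R p a b x (ltW ab).
    * move=> t; rewrite in_itv/= => /andP[at_ _]; have [c pE] := lin_coefs p.
      rewrite (_ : lin_fun p = gpoly al c); last exact/funext.
      by apply: derivable_gpoly; exact: lt_trans at_.
    * by rewrite in_itv/=.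
    * move=> t; rewrite in_itv/= => /andP[at_ tb]; rewrite xs0//.
      by apply: p_ge0; rewrite !ltW.
  + by case: ifP => //= /eqP pb; rewrite inE => /eqP->.
Qed.

(** A list of interior zeros of maximal length, which exists by the bound on
    their number, contains all of them. *)
Lemma all_zeros : exists xs, [/\ path <%R a (rcons xs b),
  {in xs, forall x, p x = 0} & forall x, a < x < b -> p x = 0 -> x \in xs].
Proof.
pose P k := `[< exists xs, [/\ path <%R a (rcons xs b), size xs = k &
  {in xs, forall x, p x = 0}] >].
have exP : exists k, P k.
  by exists 0%N; apply/asboolP; exists [::]; split; rewrite //= ab.
have ubP k : P k -> (k <= n)%N.
  move=> /asboolP[xs [pxs <- xs0]]; have := zero_index pxs xs0.
  rewrite -addnn; lia.
case: (ex_maxnP exP ubP) => k /asboolP[xs [pxs sxs xs0]] kmax.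
exists xs; split => // x xab px; apply: contrapT => /negP xxs.
have xsab : {in x :: xs, forall y, a < y < b}.
  by move=> y; rewrite inE => /predU1P[->//|]; exact: path_itv.
have uxs : uniq (x :: xs) by rewrite /= xxs (path_uniq pxs).
have [ys [pys sys xys]] := extend_points ab xsab uxs (leqnn _).
have := kmax (size ys); rewrite sys/= sxs ltnn => H.
suff : P k.+1 by move=> /H.
apply/asboolP; exists ys; split => //; first by rewrite sys/= sxs.
have [_ ysE] := uniq_min_size uxs xys (eq_leq sys).
by move=> y; rewrite -ysE inE => /predU1P[->//|]; exact: xs0.
Qed.

End Touching.

(** * Moment functionals *)

Section Moments.
Context {R : realType} {n : nat} (al : 'I_n.+1 -> R).
Variables (a b : R).
Local Notation V := (lin (powers al)).

Lemma lin_measurable (p : V) (D : set R) :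
  measurable_fun (D : set (measurableTypeR R)) (p : measurableTypeR R -> R).
Proof.
have [c pE] := lin_coefs p.
rewrite (_ : lin_fun p = gpoly al c); last exact/funext.
apply: measurable_sum => i; apply: measurable_funM; first exact: measurable_cst.
by apply: measurable_funTS; exact: measurable_powR.
Qed.

Lemma atomic_moment (L : {scalar V}) (ats : seq (R * R)) :
  {in ats, forall u, 0 <= u.1 /\ a <= u.2 <= b} ->
  (forall q, L q = \sum_(u <- ats) u.1 * q u.2) ->
  truncated_moment_functional a b L.
Proof.
move=> atsP LE.
have w_ge0 k : 0 <= (nth (0, a) ats k).1.
  have [kn|kn] := ltnP k (size ats); last by rewrite nth_default.
  by have [] := atsP _ (mem_nth (0, a) kn).
pose m_ (k : nat) : {measure set (measurableTypeR R) -> \bar R} :=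
  mscale (NngNum (w_ge0 k)) (@dirac _ (measurableTypeR R) (nth (0, a) ats k).2 R).
pose mu : {measure set (measurableTypeR R) -> \bar R} := msum m_ (size ats).
have intE (g : R -> R) : measurable_fun (`[a, b] : set (measurableTypeR R)) (g : measurableTypeR R -> R) ->
    (forall x, 0 <= g x) ->
    (\int[mu]_(x in `[a, b]) (g x)%:E)%E = (\sum_(u <- ats) u.1 * g u.2)%:E.
  move=> mg g0.
  have mE : measurable_fun (`[a, b] : set (measurableTypeR R)) (fun x : measurableTypeR R => (g x)%:E).
    exact/measurable_EFinP.
  rewrite ge0_integral_measure_sum//; last by move=> x _; rewrite lee_fin.
  rewrite (big_nth (0, a)) big_mkord -sumEFin; apply: eq_bigr => k _.
  rewrite ge0_integral_mscale//; last by move=> x _; rewrite lee_fin.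
  rewrite integral_dirac// diracE mem_set ?mul1e//=.
  by rewrite in_itv/=; have [] := atsP _ (mem_nth (0, a) (ltn_ord k)).
exists mu => q.
(* The formula for sums of measures requires nonnegative integrands. *)
have mq := lin_measurable q (D := `[a, b]).
have mp : measurable_fun (`[a, b] : set (measurableTypeR R)) (fun x : measurableTypeR R => Num.max (q x) 0).
  exact: measurable_maxr.
have mn : measurable_fun (`[a, b] : set (measurableTypeR R)) (fun x : measurableTypeR R => Num.max (- q x) 0).
  by apply: measurable_maxr => //; exact: measurableT_comp.
split.
  apply/integrableP; split; first exact/measurable_EFinP.
  have mabs : measurable_fun (`[a, b] : set (measurableTypeR R)) (fun x : measurableTypeR R => `|q x|).
    exact: measurableT_comp.
  by rewrite -[ltLHS]/(\int[mu]_(x in `[a, b]) (`|q x|)%:E)%E intE// ltry.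
rewrite integralE.
have -> : (\int[mu]_(x in `[a, b]) (fun x => (q x)%:E)^\+ x)%E =
          (\int[mu]_(x in `[a, b]) (Num.max (q x) 0)%:E)%E.
  by apply: eq_integral => x _; rewrite funeposE EFin_max.
have -> : (\int[mu]_(x in `[a, b]) (fun x => (q x)%:E)^\- x)%E =
          (\int[mu]_(x in `[a, b]) (Num.max (- q x) 0)%:E)%E.
  by apply: eq_integral => x _; rewrite funenegE EFin_max.
rewrite !intE//; [|by move=> x; rewrite le_max lexx orbT..].
rewrite -EFinB LE -sumrB; congr (_%:E); apply: eq_bigr => u _.
rewrite -mulrBr; congr (_ * _).
case: (boolP (0 <= q u.2)) => q0.
  by rewrite max_l// max_r ?subr0// oppr_le0.
have {}q0 : q u.2 <= 0 by rewrite ltW// ltNge.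
by rewrite max_r// max_l ?oppr_ge0// sub0r opprK.
Qed.

Lemma moment_ge0 (L : {scalar V}) (p : V) : truncated_moment_functional a b L ->
  nonneg_on a b p -> 0 <= L p.
Proof.
move=> [mu /(_ p)[_ Lp]] p0; rewrite -lee_fin Lp; apply: integral_ge0 => x /=.
by rewrite in_itv/= lee_fin; exact: p0.
Qed.

End Moments.

(** * The special polynomials *)

Section SpecialPolynomials.
Context {R : realType}.
Variables (n : nat) (al : 'I_n.+1 -> R).
Hypothesis alinc : forall i j : 'I_n.+1, (i < j)%N -> al i < al j.
Variables (a b : R).
Hypotheses (a_gt0 : 0 < a) (ab : a < b).
Local Notation V := (lin (powers al)).

Section Fixed.
Variables (ea : bool) (eb : option bool) (ys : seq R) (d : V).
Let ns := special_nodes ea a ys eb b.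
Hypotheses (pys : path <%R a (rcons ys b)) (sns : size (rows ns) = n).
Hypothesis dE : forall x, d x = (-1) ^+ ea * ndet al ((x, false) :: rows ns).

Lemma special_gt0 x : a <= x <= b -> x \notin [seq u.1 | u <- ns] -> 0 < d x.
Proof.
move=> xab xns; rewrite dE -[in (-1) ^+ ea](special_sign xab xns).
apply: ndet_cons_gt0 => //; first exact: special_path.
by case/andP: xab => ax _; exact: lt_le_trans ax.
Qed.

Lemma special_eq0 x : x \in [seq u.1 | u <- ns] -> d x = 0.
Proof.
by move=> /mem_rows yns; rewrite dE ndet_cons_eq0 ?mulr0// sns.
Qed.

Lemma special_ge0 : nonneg_on a b d.
Proof.
move=> x xab; case: (boolP (x \in [seq u.1 | u <- ns])) => xns.
  by rewrite special_eq0.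
exact/ltW/special_gt0.
Qed.

(** The n rows are too few for all n + 1 points of ts to be nodes. *)
Lemma special_total_gt0 (ts : seq R) : path <%R a (rcons ts b) -> size ts = n.+1 ->
  0 < total ts d.
Proof.
move=> pts sts; rewrite lt_neqAle (total_ge0 pts special_ge0) andbT eq_sym.
apply/negP => /eqP/(total_eq0 alinc a_gt0 pts sts special_ge0) d0.
have uts := path_uniq pts.
have : {subset ts <= [seq u.1 | u <- ns]}.
  move=> t tts; apply: contrapT => /negP tns.
  have /andP[at_ tb] := path_itv pts tts.
  by have := @special_gt0 t _ tns; rewrite d0 lin_zeroE ltxx !ltW// => /(_ isT).
move=> /(uniq_leq_size uts); rewrite sts size_map => nns.
suff : (size ns <= size (rows ns))%N by rewrite sns leqNgt nns.
elim: (ns) => //= [[z e] s ih]; rewrite rows_cons/= size_cat ltnS.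
exact/(leq_trans ih)/leq_addl.
Qed.

End Fixed.

Lemma special_exists (ea : bool) (eb : option bool) (ys : seq R) : exists d : V, forall x,
  d x = (-1) ^+ ea * ndet al ((x, false) :: rows (special_nodes ea a ys eb b)).
Proof.
have [d dE] := gpoly_lin al
  (fun i => (-1) ^+ ea * coef1 al (rows (special_nodes ea a ys eb b)) i).
exists d => x; rewrite dE ndet_cons_gpoly /gpoly mulr_sumr.
by apply: eq_bigr => i _; rewrite -mulrA.
Qed.

Lemma det_cvg k (F : set_system R) (A : R -> 'M[R]_k) (B : 'M[R]_k) : Filter F ->
  (forall i j, A y i j @[y --> F] --> B i j) -> \det (A y) @[y --> F] --> \det B.
Proof.
move=> FF AB; rewrite /determinant.
apply: (@cvg_big _ _ _ _ _ add_continuous _ _ _ _ _ FF) => s _.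
apply: cvgMr.
by apply: (@cvg_big _ _ _ _ _ mul_continuous _ _ _ _ _ FF) => i _; exact: AB.
Qed.

Lemma node_val_cvg (i : 'I_n.+1) (e : bool) : 0 < b ->
  node_val (powers al i) (y, e) @[y --> b] --> node_val (powers al i) (b, e).
Proof.
move=> b0.
have pc (k : R) : {for b, continuous (fun y : R => y `^ k)}.
  apply: differentiable_continuous; apply/derivable1_diffP.
  by apply: derivable_powR; rewrite in_itv/= b0.
case: e => /=; last exact: pc.
rewrite /node_val/= powR_derive1 ?in_itv/= ?b0//.
apply: cvg_trans (cvgMr (pc (al i - 1))); apply: near_eq_cvg.
near=> y; rewrite powR_derive1// in_itv/= andbT.
by near: y; exact: lt_nbhsr.
Unshelve. all: by end_near. Qed.

Lemma coef1_cvg s i : 0 < b ->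
  coef1 al (s ++ [:: (y, false); (y, true)]) i @[y --> b] -->
  coef1 al (s ++ [:: (b, false); (b, true)]) i.
Proof.
move=> b0; rewrite /coef1 /cofactor; apply: cvgMr; apply: det_cvg => k l.
rewrite !mxE /=; under eq_fun do rewrite !mxE /=.
rewrite -/(node_val _ _); under eq_fun do rewrite -/(node_val _ _).
set g := lift _ _ in k *; rewrite !nth_cat.
under eq_fun do rewrite nth_cat.
case: ifP => _; first exact: cvg_cst.
case: (_ - _)%N => [|[|[|m]]] /=; [exact: node_val_cvg..|exact: cvg_cst|exact: cvg_cst].
Qed.

Variable L : {scalar V}.

(** A double node at b is the limit of interior double nodes y as y tends to b.
    The coefficients are cofactors, hence continuous in y, and so is the value
    of L. *)
Lemma special_limit (ea : bool) (ys : seq R) : path <%R a (rcons ys b) ->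
  (forall y (d : V), path <%R a (rcons (rcons ys y) b) ->
    (forall x, d x = (-1) ^+ ea *
       ndet al ((x, false) :: rows (special_nodes ea a (rcons ys y) None b))) -> 0 <= L d) ->
  forall d : V, (forall x, d x = (-1) ^+ ea *
       ndet al ((x, false) :: rows (special_nodes ea a ys (Some true) b))) -> 0 <= L d.
Proof.
move=> pys Hy d dE.
have /choice[e eE] : forall i, exists e : V, forall x, e x = x `^ al i.
  move=> i; have [e eE] := gpoly_lin al (fun j => (j == i)%:R); exists e => x.
  rewrite eE /gpoly (bigD1 i)//= eqxx mul1r big1 ?addr0// => j /negPf->.
  by rewrite mul0r.
pose s := (if ea then single a else [::]) ++ doubles ys.
pose c y i := (-1) ^+ ea * coef1 al (s ++ [:: (y, false); (y, true)]) i.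
pose comb y : V := \sum_i c y i *: e i.
have combE y x : comb y x = (-1) ^+ ea * ndet al ((x, false) :: s ++ [:: (y, false); (y, true)]).
  rewrite lin_sumE ndet_cons_gpoly /gpoly mulr_sumr; apply: eq_bigr => i _.
  by rewrite lin_scaleE eE -mulrA.
have -> : d = comb b.
  by apply: lin_ext => x; rewrite dE combE special_rows catA.
have Lc y : L (comb y) = \sum_i c y i * L (e i).
  by rewrite linear_sum; apply: eq_bigr => i _; rewrite linearZ.
have b0 : 0 < b by exact: lt_trans ab.
have Fb : (fun y => \sum_i c y i * L (e i)) y @[y --> b] --> \sum_i c b i * L (e i).
  apply: (@cvg_big _ _ _ _ _ add_continuous _ _ _ _ _ (nbhs_filter b)) => i _.
  by apply: cvgMl; apply: cvgMr; exact: coef1_cvg.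
have Fbl := cvg_at_left_filter Fb.
rewrite Lc -(cvg_lim _ Fbl)//; apply: limr_ge; first by apply/cvg_ex; eexists; exact: Fbl.
near=> y.
have yb : y < b by near: y; exact: nbhs_left_lt.
have yl : last a ys < y.
  near: y; apply: nbhs_left_gt.
  by have := pys; rewrite rcons_path => /andP[].
rewrite -Lc; apply: (Hy y).
  by have := pys; rewrite !rcons_path last_rcons yb yl => /andP[->].
move=> x; rewrite combE special_rows cats0 /s -catA.
by rewrite /doubles map_rcons -cats1 flatten_cat.
Unshelve. all: by end_near. Qed.

End SpecialPolynomials.

(** * From special polynomials to a representing measure *)

Section MomentProblem.
Context {R : realType} {n : nat} (al : 'I_n.+1 -> R).
Hypothesis alinc : forall i j : 'I_n.+1, (i < j)%N -> al i < al j.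
Variables (a b : R).
Hypotheses (a_gt0 : 0 < a) (ab : a < b).
Local Notation V := (lin (powers al)).
Variable L : {scalar V}.

Definition nonneg_on_special (ea : bool) (m : nat) (eb : option bool) :=
  forall ys (d : V), path <%R a (rcons ys b) -> size ys = m ->
    (forall x, d x = (-1) ^+ ea * ndet al ((x, false) :: rows (special_nodes ea a ys eb b))) ->
  0 <= L d.

Lemma moment_nonneg_on_special (ea : bool) m (eb : option bool) : truncated_moment_functional a b L ->
  (ea + m.*2 + (if eb is Some d then d.+1 else 0%N))%N = n ->
  nonneg_on_special ea m eb.
Proof.
move=> Lmom nE ys d pys sys dE; apply: (moment_ge0 Lmom).
apply: (special_ge0 alinc a_gt0 pys _ dE).
by rewrite size_special_rows sys.
Qed.

(** Special polynomials of this type can be made to vanish at any k interior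
    points, at a if za holds, and at b if zb holds. *)
Definition special_fits (ea : bool) (m : nat) (eb : option bool) (za : bool) (k : nat) (zb : bool) :=
  [/\ (ea + m.*2 + (if eb is Some d then d.+1 else 0%N))%N = n, za ==> ea, (k <= m)%N & zb ==> (eb : bool)].

(** The minimizer p has at most n zeros, counted with multiplicity, so some
    special polynomial d vanishes at all of them.  Then M d = 0, that is, L d is
    the minimum lam times the positive number total d, and L d >= 0 gives
    lam >= 0.  Hence L is the sum of lam times the point evaluations that
    constitute total and of the nonnegative combination of point evaluations
    that represents M. *)
Lemma special_to_moment :
  (forall (za zb : bool) k, (za + k.*2 + zb <= n)%N ->
    exists ea m eb, special_fits ea m eb za k zb /\ nonneg_on_special ea m eb) ->
  truncated_moment_functional a b L.
Proof.
move=> HL.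
have [||ts [pts sts _]] := @extend_points R a b [::] n.+1 ab _ isT; [by []..|].
have [p [p0 p1 pmin]] := minimizer alinc a_gt0 L pts sts.
pose lam := L p.
pose Mf (q : V) : R := L q - lam * total ts q.
have totalP (k : R) (q r : V) : total ts (k *: q + r) = k * total ts q + total ts r.
  rewrite /total mulr_sumr -big_split; apply: eq_bigr => t _.
  by rewrite lin_addE lin_scaleE.
have Mlin : linear_for *%R Mf.
  by move=> k q r; rewrite /Mf linearP totalP /=; ring.
pose M : {scalar V} := HB.pack Mf (GRing.isLinear.Build _ _ _ _ Mf Mlin).
have ME q : M q = L q - lam * total ts q by [].
have M0 q : nonneg_on a b q -> 0 <= M q by move=> q0; rewrite ME subr_ge0 pmin.
have Mp : M p = 0 by rewrite ME p1 mulr1 subrr.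
have pn0 : p != 0.
  apply/eqP => pz; have := p1; rewrite pz /total big1 => [/eqP|t _].
    by rewrite eq_sym oner_eq0.
  by rewrite lin_zeroE.
have [xs [pxs xs0 xsall]] := all_zeros alinc a_gt0 ab p0 pn0.
have zeroP x : a <= x <= b -> p x = 0 -> [|| x == a, x \in xs | x == b].
  move=> /andP[ax xb] px; case: (eqVneq x a) => //= xa; case: (eqVneq x b) => xb'.
    by rewrite orbT.
  by rewrite xsall// !lt_neqAle ax xb xb' eq_sym xa.
have idx := zero_index alinc a_gt0 ab p0 pn0 pxs xs0.
have uxs := path_uniq pxs.
have xsab : {in xs, forall x, a < x < b} by move=> x; exact: path_itv.
have lam0 : 0 <= lam.
  have [ea [m [eb [[sn zaea km zbeb] Hspec]]]] := HL _ _ _ idx.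
  have [ys [pys sys xsys]] := extend_points ab xsab uxs km.
  have [d dE] := special_exists al a b ea eb ys.
  have sns : size (rows (special_nodes ea a ys eb b)) = n by rewrite size_special_rows sys.
  have Md : M d = 0.
    apply: (touch_eq0 a_gt0 ab M0 p0 Mp) => x xab px; apply: (special_eq0 sns dE).
    have := zeroP _ xab px; rewrite special_points !mem_cat => /or3P[/eqP xa|xx|/eqP xb].
    - by move: zaea; rewrite -xa px eqxx /= => ->; rewrite inE eqxx.
    - by rewrite xsys ?orbT.
    - move: zbeb; rewrite -xb px eqxx /=; case: (eb) => //= e _.
      by rewrite inE eqxx !orbT.
  have dt := special_total_gt0 alinc a_gt0 pys sns dE pts sts.
  move: Md; rewrite ME => /eqP; rewrite subr_eq0 => /eqP Ld.
  by rewrite -(pmulr_lge0 _ dt) -Ld; exact: Hspec dE.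
pose zs := (if p a == 0 then [:: a] else [::]) ++ xs ++ (if p b == 0 then [:: b] else [::]).
have zsab : {in zs, forall z, a <= z <= b}.
  move=> z; rewrite !mem_cat => /or3P[|/xsab/andP[az zb]|]; last 2 first.
  - by rewrite !ltW.
  - by case: ifP => // _; rewrite inE => /eqP->; rewrite lexx ltW.
  - by case: ifP => // _; rewrite inE => /eqP->; rewrite lexx ltW.
have uzs : uniq zs.
  have aNxs : a \notin xs by apply/negP => /xsab; rewrite ltxx.
  have bNxs : b \notin xs by apply/negP => /xsab; rewrite ltxx andbF.
  rewrite /zs; case: ifP => _; case: ifP => _; rewrite ?cats0 //= ?mem_cat ?cats1 ?rcons_uniq ?inE;
    by rewrite ?uxs ?(negPf aNxs) ?(negPf bNxs) ?(lt_eqF ab).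
have szs : (size zs <= n.+1)%N.
  rewrite /zs !size_cat addnA; move: (size xs) idx => k; rewrite -addnn.
  by case: (p a == 0); case: (p b == 0) => /=; lia.
have zsall x : a <= x <= b -> p x = 0 -> x \in zs.
  move=> xab px; rewrite !mem_cat; case/or3P: (zeroP _ xab px) => [/eqP xa|->|/eqP xb].
  - by rewrite -xa px eqxx inE eqxx.
  - by rewrite orbT.
  - by rewrite -xb px eqxx inE eqxx !orbT.
have [w [w0 MEw]] := touch_repr alinc a_gt0 ab M0 p0 Mp uzs szs zsab zsall.
apply: (@atomic_moment _ _ _ a b L ([seq (lam, t) | t <- ts] ++ [seq (w z, z) | z <- zs])).
  move=> u; rewrite mem_cat => /orP[] /mapP[t tin ->] /=; split => //.
    by have /andP[? ?] := path_itv pts tin; rewrite !ltW.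
  exact: zsab.
move=> q; rewrite big_cat !big_map /= -MEw ME -mulr_sumr.
by rewrite addrC subrK.
Qed.

End MomentProblem.

(** * The characterization *)

Theorem theorem5p2p3 (R : realType) (n : nat) (n_gt0 : (0 < n)%N)
    (alpha : 'I_n.+1 -> R)
    (alpha_ge0 : forall i, 0 <= alpha i)
    (alpha_incr : forall i j : 'I_n.+1, (i < j)%N -> alpha i < alpha j)
    (a b : R) (a_gt0 : 0 < a) (a_lt_b : a < b)
    (L : {scalar lin (powers alpha)}) :
  truncated_moment_functional a b L <->
  (forall m : nat, n = (2 * m)%N ->
     (forall (xs : m.-tuple R) (p : lin (powers alpha)),
        path <%R a (rcons xs b) ->
        (forall x, p x =
           \det (node_mx (powers alpha) (single x ++ doubles xs))) ->
        0 <= L p) /\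
     (forall (xs : (m - 1).-tuple R) (p : lin (powers alpha)),
        path <%R a (rcons xs b) ->
        (forall x, p x =
           - \det (node_mx (powers alpha)
                     (single x ++ single a ++ doubles xs ++ single b))) ->
        0 <= L p)) /\
  (forall m : nat, n = (2 * m + 1)%N ->
     (forall (xs : m.-tuple R) (p : lin (powers alpha)),
        path <%R a (rcons xs b) ->
        (forall x, p x =
           - \det (node_mx (powers alpha)
                     (single x ++ single a ++ doubles xs))) ->
        0 <= L p) /\
     (forall (xs : m.-tuple R) (p : lin (powers alpha)),
        path <%R a (rcons xs b) ->
        (forall x, p x =
           \det (node_mx (powers alpha)
                   (single x ++ doubles xs ++ single b))) ->
        0 <= L p)).
Proof.
split=> [Lmom|[Heven Hodd]].
  have spec (ea : bool) m (eb : option bool) (xs : m.-tuple R) (p : lin (powers alpha)) :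
      path <%R a (rcons xs b) ->
      (forall x, p x = (-1) ^+ ea *
         ndet alpha ((x, false) :: rows (special_nodes ea a xs eb b))) ->
      (ea + m.*2 + (if eb is Some d then d.+1 else 0%N))%N = n -> 0 <= L p.
    move=> pxs pE nE.
    exact: (moment_nonneg_on_special alpha_incr a_gt0 Lmom nE pxs (size_tuple xs) pE).
  split=> m nE; split=> xs p pxs pE.
  - apply: (spec false m None xs p pxs) => [x|]; last by lia.
    by rewrite pE special_rows /= cats0 mul1r.
  - apply: (spec true _ (Some false) xs p pxs) => [x|]; last by lia.
    by rewrite pE special_rows mulN1r.
  - apply: (spec true _ None xs p pxs) => [x|]; last by lia.
    by rewrite pE special_rows cats0 mulN1r.
  - apply: (spec false _ (Some false) xs p pxs) => [x|]; last by lia.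
    by rewrite pE special_rows mul1r.
apply: (special_to_moment alpha_incr a_gt0 a_lt_b) => za zb k kn.
have toT m ys : size ys = m -> exists xs : m.-tuple R, ys = xs.
  by move=> /eqP sys; exists (Tuple sys).
have [m [nE|nE]] : exists m, (n = 2 * m)%N \/ (n = 2 * m + 1)%N.
  by exists n./2; have := odd_double_half n; case: (odd n); lia.
- have [H1 H2] := Heven m nE.
  have [z0|z0] := boolP (za || zb).
    exists true, (m - 1)%N, (Some false); split.
      by split; rewrite ?implybT//; move: z0 kn; case: (za); case: (zb); lia.
    move=> ys d pys /toT[xs yx] dE; rewrite yx in pys dE.
    by apply: (H2 xs) => // x; rewrite dE special_rows mulN1r.
  exists false, m, None; split.
    by split; move: z0 kn; case: (za); case: (zb) => //=; lia.
  move=> ys d pys /toT[xs yx] dE; rewrite yx in pys dE.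
  by apply: (H1 xs) => // x; rewrite dE special_rows /= cats0 mul1r.
- have [H1 H2] := Hodd m nE.
  have H1' : nonneg_on_special a b L true m None.
    move=> ys d pys /toT[xs yx] dE; rewrite yx in pys dE.
    by apply: (H1 xs) => // x; rewrite dE special_rows cats0 mulN1r.
  (* If a and b are both zeros, the parity of n leaves one multiplicity
     unused, and none of the given polynomials vanishes at both endpoints; the
     polynomial with simple node a and double node b is a limit of them. *)
  have [zb0|zb0] := boolP zb; last first.
    exists true, m, None; split => //.
    by split; rewrite ?implybT//; move: zb0 kn; case: (za); case: (zb) => //=; lia.
  have [za0|za0] := boolP za; last first.
    exists false, m, (Some false); split.
      by split; move: za0 zb0 kn; case: (za); case: (zb) => //=; lia.
    move=> ys d pys /toT[xs yx] dE; rewrite yx in pys dE.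
    by apply: (H2 xs) => // x; rewrite dE special_rows mul1r.
  exists true, (m - 1)%N, (Some true); split.
    by split; rewrite ?implybT//; move: za0 zb0 kn; case: (za); case: (zb) => //=; lia.
  move=> ys d pys sys; apply: (special_limit a_gt0 a_lt_b pys) => y e pyse.
  apply: H1' => //; rewrite size_rcons sys.
  by move: za0 zb0 kn; case: (za); case: (zb) => //=; lia.
Qed.
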